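(* The graph $T_9$ is a minimal non-word-representable graph: $T_9$ is not word-representable, but every graph obtained from $T_9$ by deleting one vertex is word-representable.
   Context: A graph $G=(V,E)$ is word-representable if there exists a word $w$ over the alphabet $V$ such that for all distinct $x,y\in V$, the letters $x$ and $y$ alternate in $w$ if and only if $xy\in E$ (alternation meaning that deleting all letters other than $x$ and $y$ leaves $xyxy\cdots$ or $yxyx\cdots$). The graph $T_9$ has vertex set $\{1,\dots,10\}$; the vertices $1,2,3,4,5$ form a clique, the vertices $6,7,8,9,10$ form an independent set, and the remaining edges are: $6$ is adjacent to $1,3$; $7$ is adjacent to $1,4$; $8$ is adjacent to $2,3$; $9$ is adjacent to $1,2,3,5$; $10$ is adjacent to $1,3,4,5$. *)

(* Defs.v *)
From mathcomp Require Import all_boot.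
Set Implicit Arguments. Unset Strict Implicit. Unset Printing Implicit Defensive.

(* x and y alternate in w: deleting all letters other than x and y leaves a
   word with no two equal consecutive letters, i.e. xyxy... or yxyx... *)
Definition alternate (T : eqType) (w : seq T) (x y : T) : bool :=
  sorted (fun a b : T => a != b) [seq z <- w | (z == x) || (z == y)].

Definition word_representable (T : finType) (e : rel T) : Prop :=
  exists w : seq T, (forall x : T, x \in w) /\
    (forall x y : T, x != y -> (alternate w x y <-> e x y)).

Definition T9_edges : seq (nat * nat) :=
  [:: (1,2); (1,3); (1,4); (1,5); (2,3); (2,4); (2,5); (3,4); (3,5); (4,5);
      (6,1); (6,3); (7,1); (7,4); (8,2); (8,3);
      (9,1); (9,2); (9,3); (9,5); (10,1); (10,3); (10,4); (10,5)].

Definition T9_adj (a b : nat) : bool := ((a, b) \in T9_edges) || ((b, a) \in T9_edges).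

(* Vertex i : 'I_10 stands for the label i+1. *)
Definition T9 : rel 'I_10 := fun x y => T9_adj (nat_of_ord x).+1 (nat_of_ord y).+1.

Definition T9_del (v : 'I_10) : rel {x : 'I_10 | x != v} :=
  fun x y => T9 (val x) (val y).
Arguments T9_del v : clear implicits.

(* Main.v *)
(** Let #_z denote the number of occurrences of z in a prefix of the word w.
    For distinct letters, x and y alternate in w with x coming first exactly
    when #_y <= #_x <= #_y + 1 holds on every prefix; write x -> y for this.
    On a graph represented by w this orients every edge.  The orientation has
    no directed triangle, and if a -> b -> c -> d and a -> d, the counts along
    the path are squeezed between #_d and #_d + 1, so a -> c and b -> d, and
    these pairs are edges (semi-transitivity).  A search over the orientations
    of the edges of T9, pruned by these two rules, finds no admissible one.
    The graphs with one vertex deleted are represented by explicit words. *)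

Require Import Defs.
From mathcomp Require Import all_boot.
From mathcomp Require Import zify.

Set Implicit Arguments.
Unset Strict Implicit.
Unset Printing Implicit Defensive.

Section Alternation.

Variable T : eqType.
Implicit Types (x y z : T) (w : seq T).

Definition arc w x y : Prop :=
  forall n, count_mem y (take n w) <= count_mem x (take n w)
            <= (count_mem y (take n w)).+1.

Lemma arc_cons z w x y :
  arc (z :: w) x y <->
  forall n, (z == y) + count_mem y (take n w) <= (z == x) + count_mem x (take n w)
            <= ((z == y) + count_mem y (take n w)).+1.
Proof. by split=> A n; [exact: A n.+1 | case: n => //= n; exact: A n]. Qed.

(** An initial [x] turns #_y <= #_x <= #_y + 1 into #_x <= #_y <= #_x + 1 for the rest of the
    word. *)
Lemma arc_cons_first w x y : x != y -> arc (x :: w) x y <-> arc w y x.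
Proof.
move=> xy; rewrite arc_cons eqxx (negbTE xy).
by split=> A n; have := A n; rewrite /=; lia.
Qed.

Lemma arc_cons_second w x y : x != y -> ~ arc (y :: w) x y.
Proof.
by move=> xy /arc_cons /(_ 0); rewrite take0 eqxx eq_sym (negbTE xy).
Qed.

Lemma arc_cons_other z w x y :
  z != x -> z != y -> arc (z :: w) x y <-> arc w x y.
Proof. by move=> zx zy; rewrite arc_cons (negbTE zx) (negbTE zy). Qed.

(** Both arcs force equal counts on every prefix, yet for distinct letters the prefix ending at the
    first [x] or [y] contains only one of them; [x \in w] provides such a prefix. *)
Lemma arc_antisym w x y : x \in w -> arc w x y -> arc w y x -> x = y.
Proof.
elim: w => //= z w IHw; rewrite inE eq_sym.
have [-> _|zx /= xw Axy Ayx] := eqVneq z x.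
  by have [//|xy _ /(arc_cons_second _)] := eqVneq x y; rewrite eq_sym => /(_ xy).
have [zy|zy] := eqVneq z y.
  by have := Axy 1; rewrite /= take0 /= zy eqxx -zy (negbTE zx).
by apply: IHw => //; [apply/(arc_cons_other w zx zy) | apply/(arc_cons_other w zy zx)].
Qed.

(** The start [y] of the path acts as the last letter read, so [x] is due next; reading it swaps the
    roles, by [arc_cons_first]. *)
Lemma arc_pathP w x y : x != y ->
  path (fun a b => a != b) y [seq z <- w | (z == x) || (z == y)] <-> arc w x y.
Proof.
elim: w x y => [|z w IHw] x y xy //=.
have [->|zx] /= := eqVneq z x.
  rewrite eq_sym xy arc_cons_first //= -IHw 1?eq_sym //.
  by under eq_filter => u do rewrite orbC.
have [->|zy] /= := eqVneq z y.
  by rewrite eqxx; split=> // A; case: (@arc_cons_second w x y xy A).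
by rewrite arc_cons_other // IHw.
Qed.

Lemma alternateP w x y : x != y -> alternate w x y <-> arc w x y \/ arc w y x.
Proof.
move=> xy; have yx : y != x by rewrite eq_sym.
elim: w => [|z w IHw]; first by split=> // _; left.
rewrite /alternate /=; have [->|zx] /= := eqVneq z x.
  under eq_filter => u do rewrite orbC.
  rewrite arc_pathP // -arc_cons_first //.
  by split=> [|[] // A]; [left | case: (@arc_cons_second w y x yx A)].
have [->|zy] /= := eqVneq z y.
  rewrite arc_pathP // -arc_cons_first //.
  by split=> [|[A|//]]; [right | case: (@arc_cons_second w x y xy A)].
by rewrite !arc_cons_other.
Qed.

Lemma arc_shortcut w a b c d : arc w a b -> arc w b c -> arc w c d -> arc w a d ->
  arc w a c /\ arc w b d.
Proof.
move=> Aab Abc Acd Aad.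
by split=> n; move: (Aab n) (Abc n) (Acd n) (Aad n); lia.
Qed.

(** Around the cycle the three counts agree on every prefix, so there is also an arc from [a] to
    [c], and antisymmetry applies. *)
Lemma arc_triangle w a b c : a \in w -> arc w a b -> arc w b c -> arc w c a -> a = c.
Proof.
move=> aw Aab Abc Aca; apply: (arc_antisym aw) => // n.
by move: (Aab n) (Abc n) (Aca n); lia.
Qed.

End Alternation.

Lemma alternate_map (T U : eqType) (f : T -> U) (w : seq T) x y :
  injective f -> alternate (map f w) (f x) (f y) = alternate w x y.
Proof.
move=> f_inj; rewrite /alternate filter_map sorted_map.
under eq_filter => u do rewrite /= !(inj_eq f_inj).
by apply: eq_sorted => a b /=; rewrite (inj_eq f_inj).
Qed.

Section Search.

Variables (T : eqType) (e : rel T).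
Implicit Types (d todo : seq (T * T)) (w : seq T).

(* The conditionals stand for conjunctions and disjunctions: vm_compute
   evaluates both arguments of && and ||, which would defeat the pruning. *)
Definition conflict d : bool :=
  has (fun p => has (fun q =>
    if (p.2 == q.1) && (p.1 != q.2) then
      if (q.2, p.1) \in d then true else
      has (fun s => if (q.2 == s.1) && (p.2 != s.2) then
                      ((p.1, s.2) \in d) && ~~ (e p.1 q.2 && e p.2 s.2)
                    else false) d
    else false) d) d.

Fixpoint refutes todo d : bool :=
  if conflict d then true else
  if todo is (x, y) :: todo' then
    if refutes todo' ((x, y) :: d) then refutes todo' ((y, x) :: d) else false
  else false.

(** Restricting to the letters of [w] allows an infinite alphabet, so that the search can run on
    labels in [nat]. *)
Definition represents w : Prop :=
  {in w &, forall x y, x != y -> (alternate w x y <-> e x y)}.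

Definition arcs_of w d : Prop :=
  forall p, p \in d -> [/\ p.1 \in w, p.2 \in w & arc w p.1 p.2].

(** The inequality tests in [conflict] supply the distinctness that [arc_triangle] contradicts and
    that [represents] requires of the two shortcut pairs. *)
Lemma conflict_free w d : represents w -> arcs_of w d -> ~~ conflict d.
Proof.
move=> rw Dd; apply/negP => /hasP[[a b] /Dd/= [aw bw Aab]].
case/hasP=> [[b' c] /Dd/= [_ cw Abc]].
case: ifP => // /andP[/eqP eb ac]; rewrite -{}eb in Abc.
case: ifP => [/Dd[/= _ _ Aca] _|_].
  by rewrite (arc_triangle aw Aab Abc Aca) eqxx in ac.
case/hasP=> [[c' f] /Dd/= [_ fw Acf]].
case: ifP => // /andP[/eqP ec bf]; rewrite -{}ec in Acf.
case/andP=> /Dd[/= _ _ Aaf] /negP; apply.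
have [Aac Abf] := arc_shortcut Aab Abc Acf Aaf.
by apply/andP; split; apply/rw => //; apply/alternateP => //; left.
Qed.

(** The branch that orients each edge as [w] does collects only arcs of [w], so it never meets a
    conflict. *)
Lemma refutesF w todo d : represents w -> arcs_of w d ->
    (forall p, p \in todo -> [/\ p.1 \in w, p.2 \in w, p.1 != p.2 & e p.1 p.2]) ->
  ~~ refutes todo d.
Proof.
move=> rw; elim: todo d => [|[x y] todo IH] d Dd Dt /=.
  by rewrite (negbTE (conflict_free rw Dd)).
rewrite (negbTE (conflict_free rw Dd)) /=.
have [/= xw yw xy exy] := Dt _ (mem_head _ _).
have Dt' p : p \in todo -> [/\ p.1 \in w, p.2 \in w, p.1 != p.2 & e p.1 p.2].
  by move=> pt; apply: Dt; rewrite inE pt orbT.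
rewrite -[if _ then _ else _]/(_ && _) negb_and; apply/orP.
have /(rw _ _ xw yw xy)/(alternateP _ xy)[A|A] := exy; [left|right];
  by apply: IH => // p; rewrite inE => /predU1P[->|/Dd].
Qed.

End Search.

(** The ten clique edges head the list, so only the linear orders of the clique survive before the
    other vertices are attached. *)
Lemma T9_refuted : refutes T9_adj T9_edges [::].
Proof. by vm_compute. Qed.

Lemma T9_not_word_representable : ~ word_representable T9.
Proof.
pose f (x : 'I_10) := x.+1.
have f_inj : injective f by move=> x y [] /val_inj.
case=> w [w_all w_rep].
have f_w n : 0 < n <= 10 -> n \in map f w.
  by case: n => // n /andP[_ lt_n]; apply/mapP; exists (Ordinal lt_n).
have rw : represents T9_adj (map f w).
  move=> _ _ /mapP[x _ ->] /mapP[y _ ->].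
  by rewrite (inj_eq f_inj) alternate_map // => /w_rep.
have /negP[] : ~~ refutes T9_adj T9_edges [::]; last exact: T9_refuted.
apply: (refutesF rw) => // p pE.
have /allP/(_ p pE)/and4P[p1 p2 ne adj] : all (fun p =>
  [&& 0 < p.1 <= 10, 0 < p.2 <= 10, p.1 != p.2 & T9_adj p.1 p.2]) T9_edges by [].
by split=> //; apply: f_w.
Qed.

Lemma word_representable_map (T : finType) (U : eqType) (e : rel T) (e' : rel U)
    (f : T -> U) (w : seq U) :
    injective f -> (forall x y, e x y = e' (f x) (f y)) ->
    w =i codom f -> {in w &, forall x y, (x == y) || (alternate w x y == e' x y)} ->
  word_representable e.
Proof.
move=> f_inj ee' wf w_rep.
(* All letters of [w] lie in the image of [f], so [w] pulls back to a word [t] over [T]. *)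
have /subset_mapP[t _ Dw] : {subset w <= map f (enum T)} by move=> x; rewrite wf.
exists t; split=> [x|x y xy].
  by rewrite -(mem_map f_inj) -Dw wf codom_f.
have := w_rep (f x) (f y).
rewrite !wf !codom_f (inj_eq f_inj) (negbTE xy) Dw alternate_map // -ee'.
by move=> /(_ isT isT)/eqP->.
Qed.

(** The word at index [v] omits the label [v.+1], since ordinals are shifted by one from labels. *)
Definition T9_del_word (v : nat) : seq nat :=
  nth [::]
  [:: [:: 7; 4; 5; 7; 6; 8; 3; 10; 2; 4; 8; 7; 6; 9; 5; 3; 6; 2; 9; 8];
      [:: 4; 10; 5; 3; 7; 8; 1; 6; 4; 10; 7; 9; 5; 3; 1; 4; 9; 7; 10; 5; 6];
      [:: 6; 1; 7; 6; 5; 10; 2; 4; 9; 1; 5; 8; 2; 8; 6; 9; 10];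
      [:: 9; 5; 6; 7; 1; 7; 3; 10; 6; 2; 9; 5; 1; 8; 3; 2; 9; 8; 6];
      [:: 10; 7; 4; 6; 9; 1; 7; 3; 6; 10; 2; 4; 9; 1; 8; 3; 2; 9; 6];
      [:: 9; 10; 7; 4; 1; 7; 5; 3; 10; 2; 4; 9; 1; 5; 8];
      [:: 6; 1; 3; 6; 10; 2; 4; 9; 5; 1; 8; 3; 2; 8; 9];
      [:: 10; 7; 4; 6; 1; 7; 3; 5; 10; 6; 2; 4; 9; 1; 3; 6];
      [:: 7; 4; 1; 7; 8; 3; 2; 8; 10; 5; 4; 6; 1; 3; 6; 10];
      [:: 6; 5; 9; 7; 4; 1; 7; 3; 2; 5; 4; 9; 6; 1; 8; 3; 6]] v.

Lemma mem_T9_del_word (v n : nat) :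
  v < 10 -> (n \in T9_del_word v) = (0 < n <= 10) && (n != v.+1).
Proof.
(* As [n] is unbounded, computation settles [n < 11], and a bound on the letters of the words
   settles the rest. *)
move=> lt_v; have [n11|n11] := ltnP n 11.
  have /allP/(_ v) : all (fun v => all (fun n =>
    (n \in T9_del_word v) == (0 < n <= 10) && (n != v.+1)) (iota 0 11)) (iota 0 10).
    by vm_compute.
  by rewrite mem_iota lt_v => /(_ isT)/allP/(_ n); rewrite mem_iota n11 => /(_ isT)/eqP.
rewrite (leqNgt n) n11 andbF; apply/negP => nw.
have /allP/(_ v) : all (fun v => all (fun n => n < 11) (T9_del_word v)) (iota 0 10) by [].
by rewrite mem_iota lt_v => /(_ isT)/allP/(_ n nw); rewrite ltnNge n11.
Qed.

Lemma T9_del_word_alternate (v : nat) : v < 10 ->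
  {in T9_del_word v &, forall x y,
     (x == y) || (alternate (T9_del_word v) x y == T9_adj x y)}.
Proof.
move=> lt_v x y xw yw.
have /allP/(_ v) : all (fun v => all (fun x => all (fun y =>
    (x == y) || (alternate (T9_del_word v) x y == T9_adj x y))
  (T9_del_word v)) (T9_del_word v)) (iota 0 10) by vm_compute.
by rewrite mem_iota lt_v => /(_ isT)/allP/(_ x xw)/allP/(_ y yw).
Qed.

Lemma T9_del_word_representable (v : 'I_10) : word_representable (T9_del v).
Proof.
pose f (x : {x : 'I_10 | x != v}) := (val x).+1.
apply: (word_representable_map (e' := T9_adj) (f := f) (w := T9_del_word v)) => //.
- by move=> x y [] /val_inj/val_inj.
- move=> n; rewrite mem_T9_del_word //; apply/idP/codomP.
    case: n => // n /andP[/andP[_ lt_n] nv].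
    by exists (Sub (Ordinal lt_n) nv).
  by case=> x ->; rewrite /f ltn_ord eqSS (inj_eq val_inj) (valP x).
- exact: T9_del_word_alternate.
Qed.

Theorem theorem17 :
  ~ word_representable T9 /\ (forall v : 'I_10, word_representable (T9_del v)).
Proof.
by split; [exact: T9_not_word_representable | exact: T9_del_word_representable].
Qed.
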